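(* There is a one-to-one correspondence between skeletal ($2$-term) homotopy relative Rota-Baxter algebras and triples $(M \xrightarrow{R} A;\ N \xrightarrow{S} B;\ (\alpha,\beta,\gamma))$ in which $M \xrightarrow{R} A$ is a relative Rota-Baxter algebra, $N \xrightarrow{S} B$ (with maps $l,r$) is a bimodule over it, and $(\alpha,\beta,\gamma)\in Z^3_{\mathsf{rRB}}(M \xrightarrow{R} A; N \xrightarrow{S} B)$ is a $3$-cocycle.
   Context: All vector spaces, (multi)linear maps and tensor products are over a field $\mathbf{k}$ of characteristic $0$. Associative algebras need not be unital. **Relative Rota-Baxter algebras and bimodules.** For an associative algebra $A$ with product $\mu(a,a')=a\cdot a'$, an $A$-bimodule is a vector space $M$ with bilinear maps $l_M:A\otimes M\to M$, $(a,m)\mapsto a\cdot_M m$, and $r_M:M\otimes A\to M$, $(m,a)\mapsto m\cdot_M a$, with $(a\cdot a')\cdot_M m=a\cdot_M(a'\cdot_M m)$, $(a\cdot_M m)\cdot_M a'=a\cdot_M(m\cdot_M a')$, $(m\cdot_M a)\cdot_M a'=m\cdot_M(a\cdot a')$. A relative Rota-Baxter algebra $M\xrightarrow{R}A$ consists of an associative algebra $A$, an $A$-bimodule $M$ and a linear map $R:M\to A$ with $R(m)\cdot R(m')=R(R(m)\cdot_M m'+m\cdot_M R(m'))$ for all $m,m'\in M$. A bimodule over it is a tuple $(N\xrightarrow{S}B,l,r)$ in which $S:N\to B$ is a linear map ($2$-term chain complex), $B$ and $N$ are both $A$-bimodules, and $l:M\otimes B\to N$, $r:B\otimes M\to N$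 are bilinear maps such that for all $a\in A,b\in B,m\in M,n\in N$: - $l(a\cdot_M m,b)=a\cdot_N l(m,b)$, $l(m\cdot_M a,b)=l(m,a\cdot_B b)$, $l(m,b\cdot_B a)=l(m,b)\cdot_N a$; - $r(a\cdot_B b,m)=a\cdot_N r(b,m)$, $r(b\cdot_B a,m)=r(b,a\cdot_M m)$, $r(b,m\cdot_M a)=r(b,m)\cdot_N a$; - $R(m)\cdot_B S(n)=S(R(m)\cdot_N n+l(m,S(n)))$, $S(n)\cdot_B R(m)=S(r(S(n),m)+n\cdot_N R(m))$. **Cocycles.** $\mathcal{A}^{k-1,1}$ denotes the direct sum of all $k$-fold tensor products of $A$'s and $M$'s in which $A$ appears $k-1$ times and $M$ exactly once. For $k\ge2$, $C^k_{\mathsf{rRB}}=\mathrm{Hom}(A^{\otimes k},B)\oplus\mathrm{Hom}(\mathcal{A}^{k-1,1},N)\oplus\mathrm{Hom}(M^{\otimes k-1},B)$ and $\delta_{\mathsf{rRB}}:C^k_{\mathsf{rRB}}\to C^{k+1}_{\mathsf{rRB}}$ is $\delta_{\mathsf{rRB}}(\alpha,\beta,\gamma)=(\delta_{A,B}(\alpha),\delta^\alpha_{A,N}(\beta),\delta_{M,B}(\gamma)+h_R(\alpha,\beta))$; $Z^3_{\mathsf{rRB}}(M\xrightarrow{R}A;N\xrightarrow{S}B)$ is the kernel of $\delta_{\mathsf{rRB}}$ on $C^3_{\mathsf{rRB}}$. Here: - $\delta_{A,B}$ is the Hochschild coboundary of $A$ with coefficients in $B$: $(\delta_{A,B}f)(a_1,\dots,a_{k+1})=a_1\cdot_B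 f(a_2,\dots,a_{k+1})+\sum_{i=1}^k(-1)^i f(a_1,\dots,a_i\cdot a_{i+1},\dots,a_{k+1})+(-1)^{k+1}f(a_1,\dots,a_k)\cdot_B a_{k+1}$; - for $a_1,\dots,a_{k+1}$ with exactly one entry in $M$ and the others in $A$, $\delta^\alpha_{A,N}(\beta)(a_1,\dots,a_{k+1})=(l+l_N)(a_1,(\alpha+\beta)(a_2,\dots,a_{k+1}))+\sum_{i=1}^k(-1)^i\beta(a_1,\dots,(\mu+l_M+r_M)(a_i,a_{i+1}),\dots,a_{k+1})+(-1)^{k+1}(r+r_N)((\alpha+\beta)(a_1,\dots,a_k),a_{k+1})$, where in each sum of maps one uses the one that is defined on the given arguments (e.g. the first term is $l(a_1,\alpha(a_2,\dots,a_{k+1}))$ if $a_1\in M$ and $a_1\cdot_N\beta(a_2,\dots,a_{k+1})$ if $a_1\in A$; the last is $(-1)^{k+1}r(\alpha(a_1,\dots,a_k),a_{k+1})$ if $a_{k+1}\in M$ and $(-1)^{k+1}\beta(a_1,\dots,a_k)\cdot_N a_{k+1}$ if $a_{k+1}\in A$); - $\delta_{M,B}$ is the Hochschild coboundary (same formula, in degree equal to the number of arguments) of the associative algebra $M_{\mathrm{Tot}}=(M,\ast_R)$, $m\ast_R m'=R(m)\cdot_M m'+m\cdot_M R(m')$, with coefficients in the $M_{\mathrm{Tot}}$-bimodule $B$ with actions $m\triangleright_B b=R(m)\cdot_B b-S(l(m,b))$, $b\triangleleft_B m=b\cdot_B R(m)-S(r(b,m))$; - $h_R(\alpha,\beta)(m_1,\dots,m_k)=(-1)^k\{\alpha(R(m_1),\dots,R(m_k))-\sum_{i=1}^k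 S\circ\beta(R(m_1),\dots,m_i,\dots,R(m_k))\}$. **$2$-term $A_\infty$-algebras.** A $2$-term $A_\infty$-algebra $\mathcal{A}=(A_1\xrightarrow{d}A_0,\mu_2,\mu_3)$ consists of a linear map $d:A_1\to A_0$, bilinear maps $\mu_2:A_i\otimes A_j\to A_{i+j}$ ($0\le i,j,i+j\le1$) and a trilinear map $\mu_3:A_0\otimes A_0\otimes A_0\to A_1$ such that for $a,b,c,e\in A_0$, $p,q\in A_1$: (i) $d\mu_2(a,p)=\mu_2(a,dp)$, $d\mu_2(p,a)=\mu_2(dp,a)$; (ii) $\mu_2(dp,q)=\mu_2(p,dq)$; (iii) $d\mu_3(a,b,c)=\mu_2(\mu_2(a,b),c)-\mu_2(a,\mu_2(b,c))$, $\mu_3(a,b,dp)=\mu_2(\mu_2(a,b),p)-\mu_2(a,\mu_2(b,p))$, $\mu_3(a,dp,c)=\mu_2(\mu_2(a,p),c)-\mu_2(a,\mu_2(p,c))$, $\mu_3(dp,b,c)=\mu_2(\mu_2(p,b),c)-\mu_2(p,\mu_2(b,c))$; (iv) $\mu_3(\mu_2(a,b),c,e)-\mu_3(a,\mu_2(b,c),e)+\mu_3(a,b,\mu_2(c,e))=\mu_2(\mu_3(a,b,c),e)+\mu_2(a,\mu_3(b,c,e))$. A bimodule over $\mathcal{A}$ is $\mathcal{M}=(M_1\xrightarrow{d^{\mathcal M}}M_0,\mu_2^{\mathcal M},\mu_3^{\mathcal M})$ with $d^{\mathcal M}$ linear, bilinear maps $\mu_2^{\mathcal M}:A_i\otimes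 M_j\to M_{i+j}$ and $\mu_2^{\mathcal M}:M_i\otimes A_j\to M_{i+j}$ ($0\le i,j,i+j\le1$), and a trilinear map $\mu_3^{\mathcal M}:(A_0\otimes A_0\otimes M_0)\oplus(A_0\otimes M_0\otimes A_0)\oplus(M_0\otimes A_0\otimes A_0)\to M_1$, satisfying all identities obtained from (i)-(iv) by replacing exactly one of the variables by an element of $\mathcal{M}$ of the same degree and replacing each operation $d,\mu_2,\mu_3$ applied to arguments involving that element by $d^{\mathcal M},\mu_2^{\mathcal M},\mu_3^{\mathcal M}$. **Homotopy relative Rota-Baxter algebras.** A ($2$-term) homotopy relative Rota-Baxter operator on $\mathcal{A}$ with respect to $\mathcal{M}$ is a triple $\mathcal{R}=(R_0,R_1,R_2)$ of linear maps $R_0:M_0\to A_0$, $R_1:M_1\to A_1$ and $R_2:M_0\otimes M_0\to A_1$ such that for $m,m',m''\in M_0$, $n\in M_1$: (i) $d\circ R_1=R_0\circ d^{\mathcal M}$; (ii) $R_0(\mu_2^{\mathcal M}(R_0(m),m')+\mu_2^{\mathcal M}(m,R_0(m')))-\mu_2(R_0(m),R_0(m'))=d(R_2(m,m'))$; (iii) $R_1(\mu_2^{\mathcal M}(R_0(m),n)+\mu_2^{\mathcal M}(m,R_1(n)))-\mu_2(R_0(m),R_1(n))=R_2(m,d^{\mathcal M}(n))$; (iv) $R_1(\mu_2^{\mathcal M}(R_1(n),m)+\mu_2^{\mathcal M}(n,R_0(m)))-\mu_2(R_1(n),R_0(m))=R_2(d^{\mathcal M}(n),m)$; (v) $\mu_2(R_0(m),R_2(m',m''))-R_1(\mu_2^{\mathcal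 M}(m,R_2(m',m'')))-R_2(\mu_2^{\mathcal M}(R_0(m),m')+\mu_2^{\mathcal M}(m,R_0(m')),m'')+R_2(m,\mu_2^{\mathcal M}(R_0(m'),m'')+\mu_2^{\mathcal M}(m',R_0(m'')))-\mu_2(R_2(m,m'),R_0(m''))+R_1(\mu_2^{\mathcal M}(R_2(m,m'),m''))+R_1(\mu_3^{\mathcal M}(m,R_0(m'),R_0(m''))+\mu_3^{\mathcal M}(R_0(m),m',R_0(m''))+\mu_3^{\mathcal M}(R_0(m),R_0(m'),m''))=\mu_3(R_0(m),R_0(m'),R_0(m''))$. A ($2$-term) homotopy relative Rota-Baxter algebra $\mathcal{M}\xrightarrow{\mathcal R}\mathcal{A}$ is a triple $(\mathcal{A},\mathcal{M},\mathcal{R})$ of a $2$-term $A_\infty$-algebra, a bimodule over it, and a homotopy relative Rota-Baxter operator. It is skeletal if $d=0$ and $d^{\mathcal M}=0$. *)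

(* Defs.v *)
From HB Require Import structures.
From mathcomp Require Import all_boot all_order all_algebra.

Set Implicit Arguments.
Unset Strict Implicit.
Unset Printing Implicit Defensive.

Import GRing.Theory.
Local Open Scope ring_scope.

(* Structures are split into a record of raw operations and a predicate       *)
(* collecting the axioms, multilinearity of the operations included.          *)

Section Multilinear.
Variable K : fieldType.
Implicit Types U V W X : lmodType K.

Definition bilinear2 U V W (f : U -> V -> W) : Prop :=
  (forall v, linear (f^~ v)) /\ (forall u, linear (f u)).

Definition trilinear U V W X (f : U -> V -> W -> X) : Prop :=
  [/\ forall v w, linear (fun u => f u v w),
      forall u w, linear (fun v => f u v w)
    & forall u v, linear (fun w => f u v w)].

Definition upd T n (x : 'I_n -> T) (i : 'I_n) (t : T) : 'I_n -> T :=
  fun j => if j == i then t else x j.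

Definition multilinear n U V (f : ('I_n -> U) -> V) : Prop :=
  forall x i, linear (fun u => f (upd x i u)).

Definition uncurry2 T (W : Type) (f : T -> T -> W) : ('I_2 -> T) -> W :=
  fun x => f (x ord0) (x ord_max).

Definition uncurry3 T (W : Type) (f : T -> T -> T -> W) : ('I_3 -> T) -> W :=
  fun x => f (x ord0) (x (@Ordinal 3 1 isT)) (x ord_max).

End Multilinear.

Section RelativeRotaBaxter.
Variable K : fieldType.

Definition is_algebra (A : lmodType K) (mul : A -> A -> A) : Prop :=
  bilinear2 mul /\ associative mul.

Record is_bimodule (A M : lmodType K) (mul : A -> A -> A)
    (lM : A -> M -> M) (rM : M -> A -> M) : Prop := {
  bimod_linl : bilinear2 lM;
  bimod_linr : bilinear2 rM;
  bimod_ll : forall a a' m, lM (mul a a') m = lM a (lM a' m);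
  bimod_lr : forall a m a', rM (lM a m) a' = lM a (rM m a');
  bimod_rr : forall m a a', rM (rM m a) a' = rM m (mul a a')
}.

Record rRB_data := RRBData {
  rA : lmodType K;
  rM : lmodType K;
  rmul : rA -> rA -> rA;
  ractl : rA -> rM -> rM;
  ractr : rM -> rA -> rM;
  rR : rM -> rA
}.

Record is_rRB (X : rRB_data) : Prop := {
  rRB_algebra : is_algebra (@rmul X);
  rRB_bimodule : is_bimodule (@rmul X) (@ractl X) (@ractr X);
  rRB_linear : linear (@rR X);
  rRB_identity : forall m m' : rM X,
    rmul (rR m) (rR m') = rR (ractl (rR m) m' + ractr m (rR m'))
}.

Record rRBmod_data (A M : lmodType K) := RRBModData {
  bB : lmodType K;
  bN : lmodType K;
  bS : bN -> bB;
  bBl : A -> bB -> bB;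
  bBr : bB -> A -> bB;
  bNl : A -> bN -> bN;
  bNr : bN -> A -> bN;
  bl : M -> bB -> bN;
  br : bB -> M -> bN
}.

Record is_rRBmod (X : rRB_data) (Y : rRBmod_data (rA X) (rM X)) : Prop := {
  rRBmod_S : linear (@bS _ _ Y);
  rRBmod_B : is_bimodule (@rmul X) (@bBl _ _ Y) (@bBr _ _ Y);
  rRBmod_N : is_bimodule (@rmul X) (@bNl _ _ Y) (@bNr _ _ Y);
  rRBmod_l : bilinear2 (@bl _ _ Y);
  rRBmod_r : bilinear2 (@br _ _ Y);
  rRBmod_l1 : forall a m (b : bB Y), bl (ractl a m) b = bNl a (bl m b);
  rRBmod_l2 : forall a m (b : bB Y), bl (ractr m a) b = bl m (bBl a b);
  rRBmod_l3 : forall a m (b : bB Y), bl m (bBr b a) = bNr (bl m b) a;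
  rRBmod_r1 : forall a m (b : bB Y), br (bBl a b) m = bNl a (br b m);
  rRBmod_r2 : forall a m (b : bB Y), br (bBr b a) m = br b (ractl a m);
  rRBmod_r3 : forall a m (b : bB Y), br b (ractr m a) = bNr (br b m) a;
  rRBmod_S1 : forall m (n : bN Y),
    bBl (rR m) (bS n) = bS (bNl (rR m) n + bl m (bS n));
  rRBmod_S2 : forall m (n : bN Y),
    bBr (bS n) (rR m) = bS (br (bS n) m + bNr n (rR m))
}.

End RelativeRotaBaxter.

Section Cochains.
Variable K : fieldType.

(* (x_0, ..., x_k) |-> (x_0, ..., op x_i x_(i+1), ..., x_k) *)
Definition contract T (op : T -> T -> T) k (x : 'I_k.+1 -> T) (i : 'I_k) :
    'I_k -> T :=
  fun j => if j == i then op (x (lift ord_max i)) (x (lift ord0 i))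
           else x (lift (lift ord0 i) j).

Definition hochschild (T : Type) (V : lmodType K) (op : T -> T -> T)
    (actl : T -> V -> V) (actr : V -> T -> V) k
    (f : ('I_k -> T) -> V) (x : 'I_k.+1 -> T) : V :=
  actl (x ord0) (f (fun j => x (lift ord0 j)))
  + \sum_(i < k) (-1) ^+ i.+1 *: f (contract op x i)
  + (-1) ^+ k.+1 *: actr (f (fun j => x (lift ord_max j))) (x ord_max).

Section Mixed.
Variables A M : lmodType K.

Definition isM (t : A + M) : bool := if t is inr _ then true else false.

Definition toA (t : A + M) : A := if t is inl a then a else 0.

Definition one_M k (x : 'I_k -> A + M) : bool := #|[set i | isM (x i)]| == 1%N.

End Mixed.

(* [cochain A M B N n] carries C^(n+2). A direct sum over the positions of    *)
(* the M-factor of Hom(A (x) .. M .. (x) A, N) is encoded by one function on  *)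
(* words in A + M; it is required to vanish on the words that do not have     *)
(* exactly one letter in M, where it has no meaning.                          *)
Record cochain (A M B N : lmodType K) (n : nat) := Cochain {
  calpha : ('I_n.+2 -> A) -> B;
  cbeta : ('I_n.+2 -> A + M) -> N;
  cgamma : ('I_n.+1 -> M) -> B
}.

Definition is_cochain A M B N n (c : cochain A M B N n) : Prop :=
  [/\ multilinear (calpha c),
      (forall x i, linear (fun a : A => cbeta c (upd x i (inl a)))) /\
      (forall x i, linear (fun m : M => cbeta c (upd x i (inr m)))),
      forall x, ~~ one_M x -> cbeta c x = 0
    & multilinear (cgamma c)].

Variables (X : rRB_data K) (Y : rRBmod_data (rA X) (rM X)).
Local Notation A := (rA X).
Local Notation M := (rM X).
Local Notation B := (bB Y).
Local Notation N := (bN Y).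
Local Notation cochainXY := (cochain A M B N).

(* mu + l_M + r_M; the value on two letters of M is never used *)
Definition mixed_mul (s t : A + M) : A + M :=
  match s, t with
  | inl a, inl a' => inl (rmul a a')
  | inl a, inr m => inr (ractl a m)
  | inr m, inl a => inr (ractr m a)
  | inr _, inr _ => inr 0
  end.

(* l + l_N *)
Definition mixed_l (s : A + M) (t : B + N) : N :=
  match s, t with
  | inl a, inr n => bNl a n
  | inr m, inl b => bl m b
  | _, _ => 0
  end.

(* r + r_N *)
Definition mixed_r (t : B + N) (s : A + M) : N :=
  match t, s with
  | inr n, inl a => bNr n a
  | inl b, inr m => br b m
  | _, _ => 0
  end.

Definition alpha_plus_beta k (alpha : ('I_k -> A) -> B)
    (beta : ('I_k -> A + M) -> N) (x : 'I_k -> A + M) : B + N :=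
  if [forall i, ~~ isM (x i)] then inl (alpha (fun i => toA (x i)))
  else inr (beta x).

Definition delta_AN k (alpha : ('I_k -> A) -> B) (beta : ('I_k -> A + M) -> N)
    (x : 'I_k.+1 -> A + M) : N :=
  if one_M x then
    mixed_l (x ord0) (alpha_plus_beta alpha beta (fun j => x (lift ord0 j)))
    + \sum_(i < k) (-1) ^+ i.+1 *: beta (contract mixed_mul x i)
    + (-1) ^+ k.+1 *: mixed_r
        (alpha_plus_beta alpha beta (fun j => x (lift ord_max j))) (x ord_max)
  else 0.

Definition mul_Tot (m m' : M) : M := ractl (rR m) m' + ractr m (rR m').

Definition Tot_actl (m : M) (b : B) : B := bBl (rR m) b - bS (bl m b).

Definition Tot_actr (b : B) (m : M) : B := bBr b (rR m) - bS (br b m).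

Definition h_R k (alpha : ('I_k -> A) -> B) (beta : ('I_k -> A + M) -> N)
    (m : 'I_k -> M) : B :=
  (-1) ^+ k *: (alpha (fun j => rR (m j))
    - \sum_(i < k)
        bS (beta (fun j => if j == i then inr (m j) else inl (rR (m j))))).

Definition delta_rRB n (c : cochainXY n) : cochainXY n.+1 :=
  Cochain
    (hochschild (@rmul _ X) (@bBl _ _ _ Y) (@bBr _ _ _ Y) (calpha c))
    (delta_AN (calpha c) (cbeta c))
    (fun m => hochschild mul_Tot Tot_actl Tot_actr (cgamma c) m
              + h_R (calpha c) (cbeta c) m).

(* membership in Z^(n+2) *)
Definition is_cocycle n (c : cochainXY n) : Prop :=
  is_cochain c /\
  [/\ forall x, calpha (delta_rRB c) x = 0,
      forall x, cbeta (delta_rRB c) x = 0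
    & forall x, cgamma (delta_rRB c) x = 0].

End Cochains.

Section CocycleTriples.
Variable K : fieldType.

Record triple_data := TripleData {
  tX : rRB_data K;
  tY : rRBmod_data (rA tX) (rM tX);
  tc : cochain (rA tX) (rM tX) (bB tY) (bN tY) 1
}.

Definition is_triple (T : triple_data) : Prop :=
  [/\ is_rRB (tX T), is_rRBmod (tY T) & is_cocycle (tc T)].

Definition rRB_cocycle_triple := {T : triple_data | is_triple T}.

End CocycleTriples.

Section Homotopy.
Variable K : fieldType.

(* The suffix ij of a product is the pair of degrees of its arguments. *)
Record ainf_data := AinfData {
  A0 : lmodType K;
  A1 : lmodType K;
  dA : A1 -> A0;
  mu00 : A0 -> A0 -> A0;
  mu01 : A0 -> A1 -> A1;
  mu10 : A1 -> A0 -> A1;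
  mu3 : A0 -> A0 -> A0 -> A1
}.

Record is_ainf (H : ainf_data) : Prop := {
  ainf_lin_d : linear (@dA H);
  ainf_lin00 : bilinear2 (@mu00 H);
  ainf_lin01 : bilinear2 (@mu01 H);
  ainf_lin10 : bilinear2 (@mu10 H);
  ainf_lin3 : trilinear (@mu3 H);
  ainf_i1 : forall (a : A0 H) (p : A1 H), dA (mu01 a p) = mu00 a (dA p);
  ainf_i2 : forall (a : A0 H) (p : A1 H), dA (mu10 p a) = mu00 (dA p) a;
  ainf_ii : forall p q : A1 H, mu01 (dA p) q = mu10 p (dA q);
  ainf_iii1 : forall a b c : A0 H,
    dA (mu3 a b c) = mu00 (mu00 a b) c - mu00 a (mu00 b c);
  ainf_iii2 : forall (a b : A0 H) (p : A1 H),
    mu3 a b (dA p) = mu01 (mu00 a b) p - mu01 a (mu01 b p);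
  ainf_iii3 : forall (a c : A0 H) (p : A1 H),
    mu3 a (dA p) c = mu10 (mu01 a p) c - mu01 a (mu10 p c);
  ainf_iii4 : forall (b c : A0 H) (p : A1 H),
    mu3 (dA p) b c = mu10 (mu10 p b) c - mu10 p (mu00 b c);
  ainf_iv : forall a b c e : A0 H,
    mu3 (mu00 a b) c e - mu3 a (mu00 b c) e + mu3 a b (mu00 c e)
    = mu10 (mu3 a b c) e + mu01 a (mu3 b c e)
}.

(* l and r tell on which side the algebra acts (l : A_i (x) M_j -> M_(i+j),   *)
(* r : M_i (x) A_j -> M_(i+j)); the components of mu_3 are named after the    *)
(* kinds of their arguments.                                                  *)
Record ainfmod_data (A0 A1 : lmodType K) := AinfModData {
  M0 : lmodType K;
  M1 : lmodType K;
  dM : M1 -> M0;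
  l00 : A0 -> M0 -> M0;
  l01 : A0 -> M1 -> M1;
  l10 : A1 -> M0 -> M1;
  r00 : M0 -> A0 -> M0;
  r01 : M0 -> A1 -> M1;
  r10 : M1 -> A0 -> M1;
  mu3maa : M0 -> A0 -> A0 -> M1;
  mu3ama : A0 -> M0 -> A0 -> M1;
  mu3aam : A0 -> A0 -> M0 -> M1
}.

(* In the names below the last letter is the variable (of the identity of an  *)
(* A_oo-algebra with the same number) that is replaced by a module element.   *)
Record is_ainfmod (H : ainf_data) (L : ainfmod_data (A0 H) (A1 H)) : Prop := {
  amod_lin_d : linear (@dM _ _ L);
  amod_linl00 : bilinear2 (@l00 _ _ L);
  amod_linl01 : bilinear2 (@l01 _ _ L);
  amod_linl10 : bilinear2 (@l10 _ _ L);
  amod_linr00 : bilinear2 (@r00 _ _ L);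
  amod_linr01 : bilinear2 (@r01 _ _ L);
  amod_linr10 : bilinear2 (@r10 _ _ L);
  amod_linmaa : trilinear (@mu3maa _ _ L);
  amod_linama : trilinear (@mu3ama _ _ L);
  amod_linaam : trilinear (@mu3aam _ _ L);

  amod_i1a : forall (m : M0 L) p, dM (r01 m p) = r00 m (dA p);
  amod_i1p : forall a (n : M1 L), dM (l01 a n) = l00 a (dM n);
  amod_i2a : forall (m : M0 L) p, dM (l10 p m) = l00 (dA p) m;
  amod_i2p : forall a (n : M1 L), dM (r10 n a) = r00 (dM n) a;

  amod_iip : forall (n : M1 L) q, r01 (dM n) q = r10 n (dA q);
  amod_iiq : forall p (n : M1 L), l01 (dA p) n = l10 p (dM n);

  amod_iii1a : forall (m : M0 L) b c,
    dM (mu3maa m b c) = r00 (r00 m b) c - r00 m (mu00 b c);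
  amod_iii1b : forall a (m : M0 L) c,
    dM (mu3ama a m c) = r00 (l00 a m) c - l00 a (r00 m c);
  amod_iii1c : forall a b (m : M0 L),
    dM (mu3aam a b m) = l00 (mu00 a b) m - l00 a (l00 b m);

  amod_iii2a : forall (m : M0 L) b p,
    mu3maa m b (dA p) = r01 (r00 m b) p - r01 m (mu01 b p);
  amod_iii2b : forall a (m : M0 L) p,
    mu3ama a m (dA p) = r01 (l00 a m) p - l01 a (r01 m p);
  amod_iii2p : forall a b (n : M1 L),
    mu3aam a b (dM n) = l01 (mu00 a b) n - l01 a (l01 b n);

  amod_iii3a : forall (m : M0 L) p c,
    mu3maa m (dA p) c = r10 (r01 m p) c - r01 m (mu10 p c);
  amod_iii3p : forall a (n : M1 L) c,
    mu3ama a (dM n) c = r10 (l01 a n) c - l01 a (r10 n c);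
  amod_iii3c : forall a p (m : M0 L),
    mu3aam a (dA p) m = l10 (mu01 a p) m - l01 a (l10 p m);

  amod_iii4p : forall (n : M1 L) b c,
    mu3maa (dM n) b c = r10 (r10 n b) c - r10 n (mu00 b c);
  amod_iii4b : forall p (m : M0 L) c,
    mu3ama (dA p) m c = r10 (l10 p m) c - l10 p (r00 m c);
  amod_iii4c : forall p b (m : M0 L),
    mu3aam (dA p) b m = l10 (mu10 p b) m - l10 p (l00 b m);

  amod_iva : forall (m : M0 L) b c e,
    mu3maa (r00 m b) c e - mu3maa m (mu00 b c) e + mu3maa m b (mu00 c e)
    = r10 (mu3maa m b c) e + r01 m (mu3 b c e);
  amod_ivb : forall a (m : M0 L) c e,
    mu3maa (l00 a m) c e - mu3ama a (r00 m c) e + mu3ama a m (mu00 c e)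
    = r10 (mu3ama a m c) e + l01 a (mu3maa m c e);
  amod_ivc : forall a b (m : M0 L) e,
    mu3ama (mu00 a b) m e - mu3ama a (l00 b m) e + mu3aam a b (r00 m e)
    = r10 (mu3aam a b m) e + l01 a (mu3ama b m e);
  amod_ive : forall a b c (m : M0 L),
    mu3aam (mu00 a b) c m - mu3aam a (mu00 b c) m + mu3aam a b (l00 c m)
    = l10 (mu3 a b c) m + l01 a (mu3aam b c m)
}.

Record hop_data (A0 A1 M0 M1 : lmodType K) := HopData {
  R0 : M0 -> A0;
  R1 : M1 -> A1;
  R2 : M0 -> M0 -> A1
}.

Record is_hop (H : ainf_data) (L : ainfmod_data (A0 H) (A1 H))
    (R : hop_data (A0 H) (A1 H) (M0 L) (M1 L)) : Prop := {
  hop_lin0 : linear (R0 R);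
  hop_lin1 : linear (R1 R);
  hop_lin2 : bilinear2 (R2 R);
  hop_i : forall n : M1 L, dA (R1 R n) = R0 R (dM n);
  hop_ii : forall m m' : M0 L,
    R0 R (l00 (R0 R m) m' + r00 m (R0 R m')) - mu00 (R0 R m) (R0 R m')
    = dA (R2 R m m');
  hop_iii : forall (m : M0 L) (n : M1 L),
    R1 R (l01 (R0 R m) n + r01 m (R1 R n)) - mu01 (R0 R m) (R1 R n)
    = R2 R m (dM n);
  hop_iv : forall (m : M0 L) (n : M1 L),
    R1 R (l10 (R1 R n) m + r10 n (R0 R m)) - mu10 (R1 R n) (R0 R m)
    = R2 R (dM n) m;
  hop_v : forall m m' m'' : M0 L,
    mu01 (R0 R m) (R2 R m' m'') - R1 R (r01 m (R2 R m' m''))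
    - R2 R (l00 (R0 R m) m' + r00 m (R0 R m')) m''
    + R2 R m (l00 (R0 R m') m'' + r00 m' (R0 R m''))
    - mu10 (R2 R m m') (R0 R m'') + R1 R (l10 (R2 R m m') m'')
    + R1 R (mu3maa m (R0 R m') (R0 R m'') + mu3ama (R0 R m) m' (R0 R m'')
            + mu3aam (R0 R m) (R0 R m') m'')
    = mu3 (R0 R m) (R0 R m') (R0 R m'')
}.

Record hrRB_data := HRRBData {
  hA : ainf_data;
  hM : ainfmod_data (A0 hA) (A1 hA);
  hR : hop_data (A0 hA) (A1 hA) (M0 hM) (M1 hM)
}.

Definition is_hrRB (H : hrRB_data) : Prop :=
  [/\ is_ainf (hA H), is_ainfmod (hM H) & is_hop (hR H)].

Definition skeletal (H : hrRB_data) : Prop :=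
  (forall p : A1 (hA H), dA p = 0) /\ (forall n : M1 (hM H), dM n = 0).

Definition skeletal_hrRB := {H : hrRB_data | is_hrRB H /\ skeletal H}.

End Homotopy.

Section Correspondence.
Variable K : fieldType.
Variable H : hrRB_data K.

Definition rRB_of : rRB_data K :=
  RRBData (@mu00 _ (hA H)) (@l00 _ _ _ (hM H)) (@r00 _ _ _ (hM H)) (R0 (hR H)).

Definition rRBmod_of : rRBmod_data (rA rRB_of) (rM rRB_of) :=
  @RRBModData K (A0 (hA H)) (M0 (hM H)) _ _ (R1 (hR H))
    (@mu01 _ (hA H)) (@mu10 _ (hA H)) (@l01 _ _ _ (hM H)) (@r10 _ _ _ (hM H))
    (@r01 _ _ _ (hM H)) (@l10 _ _ _ (hM H)).

Definition beta_of : ('I_3 -> A0 (hA H) + M0 (hM H)) -> M1 (hM H) :=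
  uncurry3 (fun s t u =>
    match s, t, u with
    | inr m, inl b, inl c => mu3maa m b c
    | inl a, inr m, inl c => mu3ama a m c
    | inl a, inl b, inr m => mu3aam a b m
    | _, _, _ => 0
    end).

Definition cochain_of :
    cochain (rA rRB_of) (rM rRB_of) (bB rRBmod_of) (bN rRBmod_of) 1 :=
  @Cochain K (A0 (hA H)) (M0 (hM H)) (A1 (hA H)) (M1 (hM H)) 1
    (uncurry3 (@mu3 _ (hA H))) beta_of (uncurry2 (R2 (hR H))).

Definition triple_of : triple_data K := TripleData cochain_of.

End Correspondence.

(* Main.v *)
(** When both differentials vanish, every axiom of a homotopy relative
    Rota-Baxter algebra with a differential on one side loses that side and
    becomes one of the axioms of a relative Rota-Baxter algebra [M0 -> A0] or
    of its bimodule [M1 -> A1]. The remaining axioms are the three components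
    of the cocycle equation: the identity (iv) is [delta_{A,B} alpha = 0], its
    four module versions are [delta_{A,N} beta = 0] on the four positions of
    the module letter, and (v) is the last component. *)

Require Import Defs.
From HB Require Import structures.
From mathcomp Require Import all_boot all_order all_algebra.
From mathcomp Require Import boolp.

Import GRing.Theory.
Local Open Scope ring_scope.

(** * Finite words as functions on ordinals *)

Section Words.
Variable T : Type.

(** The default of [nth] is never reached, since the index is smaller than the length; the first
    letter serves, so that [T] need not be pointed. *)
Definition word2 (a b : T) : 'I_2 -> T := fun i => nth a [:: a; b] i.
Definition word3 (a b c : T) : 'I_3 -> T := fun i => nth a [:: a; b; c] i.
Definition word4 (a b c e : T) : 'I_4 -> T := fun i => nth a [:: a; b; c; e] i.

Lemma word2_surj (x : 'I_2 -> T) : x = word2 (x ord0) (x ord_max).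
Proof.
by apply: funext => -[[|[|//]] h]; rewrite /word2 /=; congr (x _); apply: val_inj.
Qed.

Lemma word3_surj (x : 'I_3 -> T) :
  x = word3 (x ord0) (x (@Ordinal 3 1 isT)) (x ord_max).
Proof.
by apply: funext => -[[|[|[|//]]] h]; rewrite /word3 /=; congr (x _);
   apply: val_inj.
Qed.

Lemma word4_surj (x : 'I_4 -> T) : exists a b c e, x = word4 a b c e.
Proof.
exists (x ord0), (x (@Ordinal 4 1 isT)), (x (@Ordinal 4 2 isT)), (x ord_max).
by apply: funext => -[[|[|[|[|//]]]] h]; rewrite /word4 /=; congr (x _);
   apply: val_inj.
Qed.

End Words.

Arguments word2 {T}.
Arguments word3 {T}.
Arguments word4 {T}.

Lemma forall_ord3 (P : pred 'I_3) :
  [forall i, P i] = [&& P ord0, P (@Ordinal 3 1 isT) & P ord_max].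
Proof.
apply/forallP/and3P => [h|[h0 h1 h2] [[|[|[|//]]] h]]; first by split.
- by rewrite (_ : Ordinal h = ord0) //; apply: val_inj.
- by rewrite (_ : Ordinal h = @Ordinal 3 1 isT) //; apply: val_inj.
- by rewrite (_ : Ordinal h = ord_max) //; apply: val_inj.
Qed.

(** On an explicit word the sum of booleans unfolds and computes, unlike the cardinality. *)
Lemma one_M_sum (K : fieldType) (A M : lmodType K) k (x : 'I_k -> A + M) :
  one_M x = (\sum_(i < k) isM (x i) == 1)%N.
Proof. by rewrite /one_M -sum1dep_card big_mkcond. Qed.

(** Here [a] and [e] are the outer terms of a coboundary, where a letter acts on a value of the
    cochain; moving them to the other side gives the shape of (iv). *)
Lemma alternating5_eq0 (V : zmodType) (a b c d e : V) :
  (a - b + c - d + e = 0) <-> (b - c + d = e + a).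
Proof.
have -> : a - b + c - d + e = (e + a) - (b - c + d).
  by rewrite !opprD opprK addrC !addrA.
by split=> [/subr0_eq ->|->] //; rewrite subrr.
Qed.

Lemma eq_sub0 (V : zmodType) (a b : V) : a = b -> 0 = a - b.
Proof. by move=> ->; rewrite subrr. Qed.

(** * Curried multilinear maps and Hochschild coboundaries in low degree *)

Section Multilinear.
Variables (K : fieldType) (U V : lmodType K).

Lemma multilinear_uncurry2 (f : U -> U -> V) :
  multilinear (uncurry2 f) <-> bilinear2 f.
Proof.
split=> [lf|[fl fr] x].
  split=> [v|u].
    (* The entry 0 is a placeholder that [upd] overwrites. *)
    exact: (lf (word2 0 v) ord0).
  exact: (lf (word2 u 0) ord_max).
case=> [[|[|//]] h]; rewrite /uncurry2 /upd /=; [exact: fl|exact: fr].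
Qed.

Lemma multilinear_uncurry3 (f : U -> U -> U -> V) :
  multilinear (uncurry3 f) <-> trilinear f.
Proof.
split=> [lf|[f1 f2 f3] x].
  split=> [v w|u w|u v].
  - exact: (lf (word3 0 v w) ord0).
  - exact: (lf (word3 u 0 w) (@Ordinal 3 1 isT)).
  - exact: (lf (word3 u v 0) ord_max).
by case=> [[|[|[|//]]] h]; rewrite /uncurry3 /upd /=;
   [exact: f1|exact: f2|exact: f3].
Qed.

(** For the scalar -1 and two zero vectors, linearity reads [f 0 = - f 0 + f 0]. *)
Lemma linear_at0 (f : U -> V) : linear f -> f 0 = 0.
Proof. by move=> /(_ (-1) 0 0); rewrite scaler0 addr0 scaleN1r addNr. Qed.

Lemma linear_add (f : U -> V) : linear f -> {morph f : u v / u + v}.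
Proof. by move=> lf u v; rewrite -[u in LHS]scale1r lf scale1r. Qed.

Lemma linear_zero : linear (fun _ : U => 0 : V).
Proof. by move=> a u v; rewrite scaler0 addr0. Qed.

Variables (T : Type) (op : T -> T -> T) (l : T -> V -> V) (r : V -> T -> V).

(** The last sign (-1)^(k+1) is negative for k = 2, the arity of [gamma] in a 3-cochain, and
    positive for k = 3, the arity of [alpha]. *)
Lemma hochschild2E (f : T -> T -> V) (a b c : T) :
  hochschild op l r (uncurry2 f) (word3 a b c)
  = l a (f b c) - f (op a b) c + f a (op b c) - r (f a b) c.
Proof.
rewrite /hochschild !big_ord_recl big_ord0 /uncurry2 /contract /=.
by rewrite !exprS expr0 !mulN1r !opprK !scaleN1r !scale1r addr0 !addrA.
Qed.

Lemma hochschild3E (f : T -> T -> T -> V) (a b c e : T) :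
  hochschild op l r (uncurry3 f) (word4 a b c e)
  = l a (f b c e) - f (op a b) c e + f a (op b c) e - f a b (op c e)
    + r (f a b c) e.
Proof.
rewrite /hochschild !big_ord_recl big_ord0 /uncurry3 /contract /=.
by rewrite !exprS expr0 !mulN1r !opprK !scaleN1r !scale1r addr0 !addrA.
Qed.

End Multilinear.

Arguments linear_at0 {K U V f}.
Arguments linear_add {K U V f}.

(** * The cocycle equations as axioms of a homotopy relative Rota-Baxter algebra *)

Section Correspondence.
Variables (K : fieldType) (H : hrRB_data K).
Local Notation A := (A0 (hA H)).
Local Notation M := (M0 (hM H)).
Local Notation alpha := (uncurry3 (@mu3 _ (hA H))).
Local Notation beta := (@beta_of K H).
Local Notation delta := (@delta_AN K (rRB_of H) (rRBmod_of H) 3 alpha beta).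

Definition delta_beta_eqs : Prop :=
  [/\ forall (m : M) (b c e : A),
        mu3maa (r00 m b) c e - mu3maa m (mu00 b c) e + mu3maa m b (mu00 c e)
        = r10 (mu3maa m b c) e + r01 m (mu3 b c e),
      forall a (m : M) (c e : A),
        mu3maa (l00 a m) c e - mu3ama a (r00 m c) e + mu3ama a m (mu00 c e)
        = r10 (mu3ama a m c) e + l01 a (mu3maa m c e),
      forall a b (m : M) (e : A),
        mu3ama (mu00 a b) m e - mu3ama a (l00 b m) e + mu3aam a b (r00 m e)
        = r10 (mu3aam a b m) e + l01 a (mu3ama b m e)
    & forall a b c (m : M),
        mu3aam (mu00 a b) c m - mu3aam a (mu00 b c) m + mu3aam a b (l00 c m)
        = l10 (mu3 a b c) m + l01 a (mu3aam b c m)].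

(** On words without exactly one module letter the coboundary is 0 by definition; on each of the
    four remaining patterns it is the alternating sum of one module version of (iv). *)
Lemma delta_beta_eq0 : (forall x, delta x = 0) <-> delta_beta_eqs.
Proof.
have E s t u v : one_M (word4 s t u v) -> delta (word4 s t u v) =
    mixed_l (Y := rRBmod_of H) s
      (alpha_plus_beta (X := rRB_of H) (Y := rRBmod_of H) alpha beta
         (word3 t u v))
    - beta (word3 (mixed_mul (X := rRB_of H) s t) u v)
    + beta (word3 s (mixed_mul (X := rRB_of H) t u) v)
    - beta (word3 s t (mixed_mul (X := rRB_of H) u v))
    + mixed_r (Y := rRBmod_of H)
      (alpha_plus_beta (X := rRB_of H) (Y := rRBmod_of H) alpha beta
         (word3 s t u)) v.
  rewrite /delta_AN => ->; rewrite !big_ord_recl big_ord0 /= addr0.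
  rewrite !exprS expr0 !mulN1r !opprK !scaleN1r !scale1r !addrA.
  by rewrite /contract /alpha_plus_beta !forall_ord3.
have one4 (s t u v : A + M) :
    one_M (word4 s t u v) = (isM s + isM t + isM u + isM v == 1)%N.
  by rewrite one_M_sum !big_ord_recl big_ord0 /= addn0 !addnA.
(* The hole is the expanded coboundary from [E]: vanishing of [delta] becomes an explicit
   equation. *)
have F (s t u v : A + M) :
    one_M (word4 s t u v) -> (forall x, delta x = 0) -> _ = 0 :=
  fun hs h => etrans (esym (E s t u v hs)) (h _).
split=> [h|[ha hb hc he] x].
  split=> [m b c e|a m c e|a b m e|a b c m]; apply/alternating5_eq0.
  - move: (F (inr m) (inl b) (inl c) (inl e)); rewrite one4 => /(_ isT h).
    by rewrite /alpha_plus_beta !forall_ord3.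
  - move: (F (inl a) (inr m) (inl c) (inl e)); rewrite one4 => /(_ isT h).
    by rewrite /alpha_plus_beta !forall_ord3.
  - move: (F (inl a) (inl b) (inr m) (inl e)); rewrite one4 => /(_ isT h).
    by rewrite /alpha_plus_beta !forall_ord3.
  - move: (F (inl a) (inl b) (inl c) (inr m)); rewrite one4 => /(_ isT h).
    by rewrite /alpha_plus_beta !forall_ord3.
case: (boolP (one_M x)) => [|/negPf nx]; last by rewrite /delta_AN nx.
have [s [t [u [v ->]]]] := word4_surj _ x => h1; rewrite E //.
move: h1; rewrite one4 /alpha_plus_beta !forall_ord3.
(* Of the sixteen letter patterns four survive the count, with the module letter moving from the
   last position to the first. *)
by case: s t u v => [a|a] [b|b] [c|c] [e|e] //= _; apply/alternating5_eq0;
  [exact: he|exact: hc|exact: hb|exact: ha].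
Qed.

(** The three components of [mu3] on the module live on disjoint letter patterns, so linearity of
    [beta] in each slot splits into theirs. *)
Lemma beta_of_cochain :
  [/\ forall x i, linear (fun a : A => beta (upd x i (inl a))),
      forall x i, linear (fun m : M => beta (upd x i (inr m)))
    & forall x, ~~ one_M x -> beta x = 0] <->
  [/\ trilinear (@mu3maa _ _ _ (hM H)), trilinear (@mu3ama _ _ _ (hM H))
    & trilinear (@mu3aam _ _ _ (hM H))].
Proof.
split=> [[bl br _]|[[m1 m2 m3] [a1 a2 a3] [e1 e2 e3]]].
  split; split=> u v.
  (* The slot under study holds the placeholder [inl 0], even where [upd] puts a module letter. *)
  - exact: (br (word3 (inl 0) (inl u) (inl v)) ord0).
  - exact: (bl (word3 (inr u) (inl 0) (inl v)) (@Ordinal 3 1 isT)).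
  - exact: (bl (word3 (inr u) (inl v) (inl 0)) ord_max).
  - exact: (bl (word3 (inl 0) (inr u) (inl v)) ord0).
  - exact: (br (word3 (inl u) (inl 0) (inl v)) (@Ordinal 3 1 isT)).
  - exact: (bl (word3 (inl u) (inr v) (inl 0)) ord_max).
  - exact: (bl (word3 (inl 0) (inl u) (inr v)) ord0).
  - exact: (bl (word3 (inl u) (inl 0) (inr v)) (@Ordinal 3 1 isT)).
  - exact: (br (word3 (inl u) (inl v) (inl 0)) ord_max).
split=> [x i|x i|x].
(* In each of the eight patterns and three slots, either the map is identically 0 or it is covered
   by one of the nine linearity hypotheses. *)
- rewrite (word3_surj _ x); case: (x _) (x _) (x _) => [a|a] [b|b] [c|c];
  case: i => [[|[|[|//]]] hi]; rewrite /beta_of /uncurry3 /upd /word3 /=;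
  first [exact: linear_zero | done].
- rewrite (word3_surj _ x); case: (x _) (x _) (x _) => [a|a] [b|b] [c|c];
  case: i => [[|[|[|//]]] hi]; rewrite /beta_of /uncurry3 /upd /word3 /=;
  first [exact: linear_zero | done].
- rewrite (word3_surj _ x) one_M_sum !big_ord_recl big_ord0 /=.
  by case: (x _) (x _) (x _) => [a|a] [b|b] [c|c].
Qed.

(** The coboundary of [M_Tot] in degree two, whose actions contribute the corrections by [R1], is
    followed by [h_R] with the sign (-1)^3. *)
Lemma delta_gammaE (m m' m'' : M) :
  cgamma (delta_rRB (cochain_of H)) (word3 m m' m'') =
  mu01 (R0 (hR H) m) (R2 (hR H) m' m'')
    - R1 (hR H) (r01 m (R2 (hR H) m' m''))
  - R2 (hR H) (l00 (R0 (hR H) m) m' + r00 m (R0 (hR H) m')) m''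
  + R2 (hR H) m (l00 (R0 (hR H) m') m'' + r00 m' (R0 (hR H) m''))
  - (mu10 (R2 (hR H) m m') (R0 (hR H) m'')
     - R1 (hR H) (l10 (R2 (hR H) m m') m''))
  - (mu3 (R0 (hR H) m) (R0 (hR H) m') (R0 (hR H) m'')
     - (R1 (hR H) (mu3maa m (R0 (hR H) m') (R0 (hR H) m''))
        + R1 (hR H) (mu3ama (R0 (hR H) m) m' (R0 (hR H) m''))
        + R1 (hR H) (mu3aam (R0 (hR H) m) (R0 (hR H) m') m''))).
Proof.
rewrite [LHS]/= hochschild2E /h_R !big_ord_recl big_ord0 /=.
by rewrite !exprS expr0 !mulN1r !opprK !scaleN1r addr0 !addrA.
Qed.

(** Linearity of [R1] gathers the three terms of [h_R] involving [beta] into the single [R1] of a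
    sum in (v). *)
Lemma delta_gamma_eq0 : linear (R1 (hR H)) ->
  (forall x, cgamma (delta_rRB (cochain_of H)) x = 0) <->
  (forall m m' m'' : M,
    mu01 (R0 (hR H) m) (R2 (hR H) m' m'')
      - R1 (hR H) (r01 m (R2 (hR H) m' m''))
    - R2 (hR H) (l00 (R0 (hR H) m) m' + r00 m (R0 (hR H) m')) m''
    + R2 (hR H) m (l00 (R0 (hR H) m') m'' + r00 m' (R0 (hR H) m''))
    - mu10 (R2 (hR H) m m') (R0 (hR H) m'')
    + R1 (hR H) (l10 (R2 (hR H) m m') m'')
    + R1 (hR H) (mu3maa m (R0 (hR H) m') (R0 (hR H) m'')
        + mu3ama (R0 (hR H) m) m' (R0 (hR H) m'')
        + mu3aam (R0 (hR H) m) (R0 (hR H) m') m'')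
    = mu3 (R0 (hR H) m) (R0 (hR H) m') (R0 (hR H) m'')).
Proof.
move=> lR.
have E (a b c e f g h k : A1 (hA H)) :
    a - b - c + e - (f - g) - (h - k) = a - b - c + e - f + g + k - h.
  by rewrite !opprB !addrA (addrAC _ g).
split=> [h m m' m''|h x].
  have := h (word3 m m' m''); rewrite delta_gammaE E -!(linear_add lR).
  exact: subr0_eq.
rewrite (word3_surj _ x) delta_gammaE E -!(linear_add lR) h; exact: subrr.
Qed.

(** Stating an equivalence on raw data lets it validate the inverse construction too. A differential
    inside an operation becomes a zero argument, which multilinearity kills. *)
Lemma is_triple_of :
  skeletal H -> (is_hrRB H <-> is_triple (triple_of H)).
Proof.
move=> [d0 dM0]; split.
- case=> HA HM HR.
  have := ainf_lin3 HA => /[dup] tri3 [t1 t2 t3].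
  have [e1 e2 e3] := amod_linaam HM.
  have [f1 f2 f3] := amod_linama HM.
  have [g1 g2 g3] := amod_linmaa HM.
  have [r1 r2] := hop_lin2 HR.
  split=> /=.
  + split=> /=.
    * split; first exact: ainf_lin00 HA.
      by move=> a b c; apply/esym/subr0_eq; rewrite -(ainf_iii1 HA) d0.
    * split=> /=; [exact: amod_linl00 HM|exact: amod_linr00 HM|..] => *.
      - by apply: subr0_eq; rewrite -(amod_iii1c HM) dM0.
      - by apply: subr0_eq; rewrite -(amod_iii1b HM) dM0.
      - by apply: subr0_eq; rewrite -(amod_iii1a HM) dM0.
    * exact: hop_lin0 HR.
    * by move=> m m'; apply/esym/subr0_eq; rewrite (hop_ii HR) d0.
  + split=> /=.
    * exact: hop_lin1 HR.
    * split=> /=; [exact: ainf_lin01 HA|exact: ainf_lin10 HA|..] => *;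
        apply: subr0_eq.
      - by rewrite -(ainf_iii2 HA) d0 linear_at0.
      - by rewrite -(ainf_iii3 HA) d0 (linear_at0 (t2 _ _)).
      - by rewrite -(ainf_iii4 HA) d0 (linear_at0 (t1 _ _)).
    * split=> /=; [exact: amod_linl01 HM|exact: amod_linr10 HM|..] => *;
        apply: subr0_eq.
      - by rewrite -(amod_iii2p HM) dM0 linear_at0.
      - by rewrite -(amod_iii3p HM) dM0 (linear_at0 (f2 _ _)).
      - by rewrite -(amod_iii4p HM) dM0 (linear_at0 (g1 _ _)).
    * exact: amod_linr01 HM.
    * exact: amod_linl10 HM.
    (* The six compatibilities of [l] and [r] are the versions of (iii) with one letter in [A1] and
       one in [M0]. *)
    * move=> a m b; apply: subr0_eq.
      by rewrite -(amod_iii2b HM) d0 linear_at0.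
    * move=> a m b; apply: subr0_eq.
      by rewrite -(amod_iii2a HM) d0 linear_at0.
    * move=> a m b; apply/esym/subr0_eq.
      by rewrite -(amod_iii3a HM) d0 (linear_at0 (g2 _ _)).
    * move=> a m b; apply: subr0_eq.
      by rewrite -(amod_iii3c HM) d0 (linear_at0 (e2 _ _)).
    * move=> a m b; apply: subr0_eq.
      by rewrite -(amod_iii4c HM) d0 (linear_at0 (e1 _ _)).
    * move=> a m b; apply/esym/subr0_eq.
      by rewrite -(amod_iii4b HM) d0 (linear_at0 (f1 _ _)).
    (* The two conditions on [S] are (iii) and (iv) of the operator, where [R2] receives a zero
       argument. *)
    * move=> m n; apply/esym/subr0_eq.
      by rewrite (hop_iii HR) dM0 linear_at0.
    * move=> m n; apply/esym/subr0_eq.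
      by rewrite (hop_iv HR) dM0 (linear_at0 (r1 _)).
  + have [b1 b2 b3] : _ := beta_of_cochain.2
      (And3 (amod_linmaa HM) (amod_linama HM) (amod_linaam HM)).
    split; split=> //.
    * exact/multilinear_uncurry3.
    * by apply/multilinear_uncurry2; exact: hop_lin2 HR.
    * move=> x; have [a [b [c [e ->]]]] := word4_surj _ x.
      rewrite [LHS]/= hochschild3E; apply/alternating5_eq0.
      exact: (ainf_iv HA a b c e).
    * apply/delta_beta_eq0; split; [exact: amod_iva HM|exact: amod_ivb HM|
        exact: amod_ivc HM|exact: amod_ive HM].
    * apply/delta_gamma_eq0; [exact: hop_lin1 HR|exact: hop_v HR].
(* Conversely, (i) and (ii) of the algebra and module have both sides 0, and each version of (iii)
   is an associativity or compatibility law written as a vanishing difference. *)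
- case=> /= HX HY [[/= /multilinear_uncurry3 tri3 [b1 b2] b3
    /multilinear_uncurry2 lR2] [za zb zc]].
  have [tm ta te] := beta_of_cochain.1 (And3 b1 b2 b3).
  have [t1 t2 t3] := tri3.
  have [e1 e2 e3] := te.
  have [f1 f2 f3] := ta.
  have [g1 g2 g3] := tm.
  have [r1 r2] := lR2.
  have [z1 z2 z3 z4] := delta_beta_eq0.1 zb.
  have zc' := (delta_gamma_eq0 (rRBmod_S HY)).1 zc.
  (* These facts are restated, by conversion, in terms of the operations of [H], the form met in the
     goals below. *)
  have [lmu amu] : is_algebra (@mu00 _ (hA H)) := rRB_algebra HX.
  have BM : is_bimodule (@mu00 _ (hA H)) (@l00 _ _ _ (hM H))
    (@r00 _ _ _ (hM H)) := rRB_bimodule HX.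
  have BB : is_bimodule (@mu00 _ (hA H)) (@mu01 _ (hA H))
    (@mu10 _ (hA H)) := rRBmod_B HY.
  have BN : is_bimodule (@mu00 _ (hA H)) (@l01 _ _ _ (hM H))
    (@r10 _ _ _ (hM H)) := rRBmod_N HY.
  have lR0 : linear (R0 (hR H)) := rRB_linear HX.
  have lR1 : linear (R1 (hR H)) := rRBmod_S HY.
  have [r01l r01r] : bilinear2 (@r01 _ _ _ (hM H)) := rRBmod_l HY.
  have [l10l l10r] : bilinear2 (@l10 _ _ _ (hM H)) := rRBmod_r HY.
  split.
  + split=> //.
    * by move=> a u v; rewrite !d0 scaler0 addr0.
    * exact: bimod_linl BB.
    * exact: bimod_linr BB.
    * by move=> a p; rewrite !d0 (linear_at0 (lmu.2 a)).
    * by move=> a p; rewrite !d0 (linear_at0 (lmu.1 a)).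
    * move=> p q; rewrite !d0 (linear_at0 ((bimod_linl BB).1 q)).
      by rewrite (linear_at0 ((bimod_linr BB).2 p)).
    * by move=> a b c; rewrite d0; exact: eq_sub0 (esym (amu a b c)).
    * move=> a b p; rewrite d0 (linear_at0 (t3 a b)).
      exact: eq_sub0 (bimod_ll BB a b p).
    * move=> a c p; rewrite d0 (linear_at0 (t2 a c)).
      exact: eq_sub0 (bimod_lr BB a p c).
    * move=> b c p; rewrite d0 (linear_at0 (t1 b c)).
      exact: eq_sub0 (bimod_rr BB p b c).
    * move=> a b c e; apply/alternating5_eq0.
      have := za (word4 a b c e); rewrite [X in X = _]/= hochschild3E; exact.
  + split=> //.
    * by move=> a u v; rewrite !dM0 scaler0 addr0.
    * exact: bimod_linl BM.
    * exact: bimod_linl BN.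
    * exact: bimod_linr BM.
    * exact: bimod_linr BN.
    * by move=> m p; rewrite d0 dM0 (linear_at0 ((bimod_linr BM).2 m)).
    * by move=> a n; rewrite !dM0 (linear_at0 ((bimod_linl BM).2 a)).
    * by move=> m p; rewrite d0 dM0 (linear_at0 ((bimod_linl BM).1 m)).
    * by move=> a n; rewrite !dM0 (linear_at0 ((bimod_linr BM).1 a)).
    * move=> n q; rewrite d0 dM0 (linear_at0 (r01l q)).
      by rewrite (linear_at0 ((bimod_linr BN).2 n)).
    * move=> p n; rewrite d0 dM0 (linear_at0 (l10r p)).
      by rewrite (linear_at0 ((bimod_linl BN).1 n)).
    * by move=> m b c; rewrite dM0; exact: eq_sub0 (bimod_rr BM m b c).
    * by move=> a m c; rewrite dM0; exact: eq_sub0 (bimod_lr BM a m c).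
    * by move=> a b m; rewrite dM0; exact: eq_sub0 (bimod_ll BM a b m).
    * move=> m b p; rewrite d0 (linear_at0 (g3 m b)).
      exact: eq_sub0 (rRBmod_l2 HY b m p).
    * move=> a m p; rewrite d0 (linear_at0 (f3 a m)).
      exact: eq_sub0 (rRBmod_l1 HY a m p).
    * move=> a b n; rewrite dM0 (linear_at0 (e3 a b)).
      exact: eq_sub0 (bimod_ll BN a b n).
    * move=> m p c; rewrite d0 (linear_at0 (g2 m c)).
      exact: eq_sub0 (esym (rRBmod_l3 HY c m p)).
    * move=> a n c; rewrite dM0 (linear_at0 (f2 a c)).
      exact: eq_sub0 (bimod_lr BN a n c).
    * move=> a p m; rewrite d0 (linear_at0 (e2 a m)).
      exact: eq_sub0 (rRBmod_r1 HY a m p).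
    * move=> n b c; rewrite dM0 (linear_at0 (g1 b c)).
      exact: eq_sub0 (bimod_rr BN n b c).
    * move=> p m c; rewrite d0 (linear_at0 (f1 m c)).
      exact: eq_sub0 (esym (rRBmod_r3 HY c m p)).
    * move=> p b m; rewrite d0 (linear_at0 (e1 b m)).
      exact: eq_sub0 (rRBmod_r2 HY b m p).
  + split=> //.
    * by move=> n; rewrite d0 dM0 (linear_at0 lR0).
    * move=> m m'; rewrite d0.
      exact/esym/eq_sub0/esym/(rRB_identity HX m m').
    * move=> m n; rewrite dM0 (linear_at0 (r2 m)).
      exact/esym/eq_sub0/esym/(rRBmod_S1 HY m n).
    * move=> m n; rewrite dM0 (linear_at0 (r1 m)).
      exact/esym/eq_sub0/esym/(rRBmod_S2 HY m n).
Qed.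

End Correspondence.

(** * The inverse construction *)

Section Inverse.
Variable K : fieldType.

(** The map [br] becomes the left action [l10] and [bl] the right action [r01]: in [bl] and [br] the
    letter tells the side of the element of [M], in the other names the side of the algebra. *)
Definition hrRB_of (T : triple_data K) : hrRB_data K :=
  let al := calpha (tc T) in let be := cbeta (tc T) in
  let HA := @AinfData K (rA (tX T)) (bB (tY T)) (fun _ => 0)
    (@rmul _ (tX T)) (@bBl _ _ _ (tY T)) (@bBr _ _ _ (tY T))
    (fun a b c => al (word3 a b c)) in
  let HM := @AinfModData K (A0 HA) (A1 HA) (rM (tX T)) (bN (tY T)) (fun _ => 0)
    (@ractl _ (tX T)) (@bNl _ _ _ (tY T)) (@br _ _ _ (tY T))
    (@ractr _ (tX T)) (@bl _ _ _ (tY T)) (@bNr _ _ _ (tY T))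
    (fun m a b => be (word3 (inr m) (inl a) (inl b)))
    (fun a m b => be (word3 (inl a) (inr m) (inl b)))
    (fun a b m => be (word3 (inl a) (inl b) (inr m))) in
  @HRRBData K HA HM
    (@HopData K (A0 HA) (A1 HA) (M0 HM) (M1 HM) (@rR _ (tX T)) (@bS _ _ _ (tY T))
      (fun m m' => cgamma (tc T) (word2 m m'))).

Lemma skeletal_hrRB_of (T : triple_data K) : skeletal (hrRB_of T).
Proof. by []. Qed.

(** The rebuilt [beta] is 0 on words without exactly one module letter, and the support condition on
    cochains says the same of the original. *)
Lemma hrRB_ofK (T : triple_data K) :
  is_triple T -> triple_of (hrRB_of T) = T.
Proof.
case: T => -[A M mul al ar R] [/= B N S Bl Br Nl Nr l r] [/= al3 be ga].
case=> _ _ [[_ _ be0 _] _].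
congr (@TripleData K (RRBData mul al ar R)
  (RRBModData S Bl Br Nl Nr l r) (Cochain _ _ _)) => /=.
- by apply: funext => x; rewrite [x in RHS]word3_surj.
- apply: funext => x; rewrite /beta_of /uncurry3 /= [x in RHS]word3_surj.
  case: (x _) (x _) (x _) => [a|a] [b|b] [c|c] //;
  by apply/esym/be0; rewrite one_M_sum !big_ord_recl big_ord0.
- by apply: funext => x; rewrite [x in RHS]word2_surj.
Qed.

(** Once extensionality replaces both differentials by the zero function, the two sides are
    convertible, as uncurried maps compute on explicit words. *)
Lemma triple_ofK (H : hrRB_data K) :
  skeletal H -> hrRB_of (triple_of H) = H.
Proof.
case: H => -[A0 A1 d mu00 mu01 mu10 mu3].
case=> [/= M0 M1 dM l00 l01 l10 r00 r01 r10 maa ama aam] [/= R0 R1 R2].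
case=> /= d0 dM0.
have -> : d = fun _ => 0 by apply: funext.
by have -> : dM = fun _ => 0 by apply: funext.
Qed.

End Inverse.

Theorem theorem6p7 (K : fieldType) (charK : [pchar K] =i pred0) :
  exists f : skeletal_hrRB K -> rRB_cocycle_triple K,
    bijective f /\ (forall H, sval (f H) = triple_of (sval H)).
Proof.
pose f (H : skeletal_hrRB K) : rRB_cocycle_triple K :=
  exist _ (triple_of (sval H))
    ((is_triple_of K _ (svalP H).2).1 (svalP H).1).
(* The triple of the rebuilt structure is [T] itself, so its validity transfers back. *)
have hg (T : rRB_cocycle_triple K) : is_hrRB (hrRB_of K (sval T)).
  apply/(is_triple_of K _ (skeletal_hrRB_of K (sval T))).
  by rewrite hrRB_ofK; exact: svalP T.
pose g (T : rRB_cocycle_triple K) : skeletal_hrRB K :=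
  exist _ (hrRB_of K (sval T)) (conj (hg T) (skeletal_hrRB_of K (sval T))).
(* Proof irrelevance reduces equality in the subtypes to equality of the raw data. *)
exists f; split=> //; exists g => [[H [h1 h2]]|[T hT]]; apply: eq_exist => /=.
  exact: triple_ofK.
exact: hrRB_ofK.
Qed.
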